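(* Let $0\le m\le\infty$, let $(\Gamma_i)_{i=1}^m$ be graph limits in $\mathcal U_\infty$, and let $(\alpha_i)_{i=1}^m$ be weights with $\alpha_i\ge0$ for every $i$ and $\sum_{i=1}^m\alpha_i\le1$. Suppose that, for each $i$, the graph limit $\Gamma_i$ is represented by a kernel $W_i$ on a probability space $(\mathcal S_i,\mu_i)$. Then the graph limit $\bigoplus_{i=1}^m\alpha_i\Gamma_i$ is represented by the kernel $\bigoplus_{i=1}^m\alpha_iW_i$.
   Context: Graphs are finite, simple, undirected, with at least one vertex; $v(G)=|V(G)|$, $e(G)=|E(G)|$. Graph limits. For graphs $F,G$, $t(F,G)$ is the probability that a uniformly random map $V(F)\to V(G)$ is a graph homomorphism (maps edges to edges). The set $\mathcal U$ of unlabelled graphs (isomorphism classes) is embedded as a dense subset of a compact metric space $\overline{\mathcal U}$; the elements of $\mathcal U_\infty=\overline{\mathcal U}\setminus\mathcal U$ are called graph limits, and $v(\Gamma)=\infty$ for $\Gamma\in\mathcal U_\infty$. Each $t(F,\cdot)$ extends continuously to $\overline{\mathcal U}$; a graph limit $\Gamma$ is determined by the numbers $t(F,\Gamma)$, $F$ ranging over all graphs; and a sequence $G_n$ in $\overline{\mathcal U}$ converges to $\Gamma\in\mathcal U_\infty$ iff $v(G_n)\to\infty$ and $t(F,G_n)\to t(F,\Gamma)$ for every graph $F$. (Concretely, graph limits can be identified with the families $(t_F)_F$ arising as $t_F=\lim_n t(F,G_n)$ for sequences of graphs with $v(G_n)\to\infty$ for which all these limits exist.) Direct sums of graph limits. For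 $0\le m\le\infty$, graph limits $(\Gamma_i)_{i=1}^m$ and weights $\alpha_i\ge0$ with $\sum_{i=1}^m\alpha_i\le1$, $\bigoplus_{i=1}^m\alpha_i\Gamma_i$ is the unique graph limit $\Gamma$ with $t(F,\Gamma)=\sum_{i=1}^m\alpha_i^{v(F)}t(F,\Gamma_i)$ for every connected graph $F$ with at least one edge. (For $m=0$ it is the trivial graph limit $\mathbf 0$, with $t(F,\mathbf 0)=0$ if $e(F)\ge1$ and $1$ if $e(F)=0$.) Kernels. A kernel on a probability space $(\mathcal S,\mu)$ is a symmetric measurable function $W:\mathcal S\times\mathcal S\to[0,1]$. It represents the unique graph limit $\Gamma_W$ satisfying $t(F,\Gamma_W)=\int_{\mathcal S^{v(F)}}\prod_{ij\in E(F)}W(x_i,x_j)\,d\mu(x_1)\cdots d\mu(x_{v(F)})$ for every graph $F$ (with vertices labelled $1,\dots,v(F)$). Direct sums of kernels. Let $W_i$ be a kernel on a probability space $(\mathcal S_i,\mu_i)$ for each $i$. If $\sum_{i=1}^m\alpha_i=1$, let $\mathcal S$ be the disjoint union of the $\mathcal S_i$, with probability measure $\mu(A)=\sum_{i=1}^m\alpha_i\mu_i(A\cap\mathcal S_i)$; then $\bigoplus_{i=1}^m\alpha_iW_i$ is the kernel $W$ on $(\mathcal S,\mu)$ with $W(x,y)=W_i(x,y)$ if $x,y\in\mathcal S_i$, and $W(x,y)=0$ if $x\in\mathcal S_i$, $y\in\mathcal S_j$ with $i\ne j$. If $\sum_{i=1}^m\alpha_i<1$, take any probability space $(\mathcal S_0,\mu_0)$,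 let $W_0=0$ on $\mathcal S_0\times\mathcal S_0$ and $\alpha_0=1-\sum_{i=1}^m\alpha_i$, and define $\bigoplus_{i=1}^m\alpha_iW_i$ to be $\bigoplus_{i=0}^m\alpha_iW_i$ (any choice of $(\mathcal S_0,\mu_0)$ is allowed). *)

(* Defs.v *)
From HB Require Import structures.
From mathcomp Require Import all_boot all_order all_algebra.
From mathcomp Require Import all_classical all_reals all_analysis.

Set Implicit Arguments.
Unset Strict Implicit.
Unset Printing Implicit Defensive.

Import Order.TTheory GRing.Theory Num.Theory.
Import numFieldNormedType.Exports.

Local Open Scope classical_set_scope.
Local Open Scope ring_scope.

(* Every finite graph is isomorphic to one on the vertices 0, ..., n - 1, and
   the densities below are invariant under isomorphism.  Keeping graphs in a
   small universe allows functions on graphs to be elements of a choiceType. *)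
Record graph := Graph {
  nverts : nat;
  nverts_gt0 : (0 < nverts)%N;
  edge : rel 'I_nverts;
  edge_sym : symmetric edge;
  edge_irr : irreflexive edge }.
Arguments edge : clear implicits.

Definition has_edge (F : graph) : Prop := exists x y, edge F x y.

Definition connected_graph (F : graph) : Prop :=
  forall x y, connect (edge F) x y.

Definition is_hom (F G : graph) (f : {ffun 'I_(nverts F) -> 'I_(nverts G)}) :=
  [forall x, forall y, edge F x y ==> edge G (f x) (f y)].

Definition hom_density (R : realType) (F G : graph) : R :=
  #|[pred f | @is_hom F G f]|%:R /
  #|{ffun 'I_(nverts F) -> 'I_(nverts G)}|%:R.

(* A graph limit is identified with its family of densities t(F, _). *)
Record graph_limit (R : realType) := GraphLimit {
  limit_density :> graph -> R;
  limit_densityP : exists G : nat -> graph,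
    (nverts (G n) @[n --> \oo] --> \oo) /\
    (forall F, hom_density R F (G n) @[n --> \oo] --> limit_density F) }.

HB.instance Definition _ (R : realType) := gen_eqMixin (graph_limit R).
HB.instance Definition _ (R : realType) := gen_choiceMixin (graph_limit R).

Section TrivialLimit.
Variable R : realType.

Definition empty_graph (n : nat) : graph.
Proof.
by refine (@Graph n.+1 _ (fun _ _ => false) _ _).
Defined.

Definition trivial_density (F : graph) : R :=
  if [exists x, exists y, edge F x y] then 0 else 1.

Lemma hom_density_empty F n : hom_density R F (empty_graph n) = trivial_density F.
Proof.
rewrite /hom_density /trivial_density; case: ifPn => [/existsP[x /existsP[y xy]]|H].
  rewrite eq_card0 ?mul0r// => f; rewrite !inE; apply/negbTE/negP.
  by move=> /forallP/(_ x)/forallP/(_ y); rewrite xy.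
rewrite (_ : #|[pred f | _]| = #|{ffun 'I_(nverts F) -> 'I_n.+1}|); last first.
  apply: eq_card => f; rewrite !inE; apply/forallP => x; apply/forallP => y.
  by apply/implyP => xy; case/negP: H; apply/existsP; exists x; apply/existsP; exists y.
rewrite divff// pnatr_eq0 -lt0n card_ffun !card_ord.
by rewrite expn_gt0.
Qed.

Lemma trivial_densityP : exists G : nat -> graph,
    (nverts (G n) @[n --> \oo] --> \oo) /\
    (forall F, hom_density R F (G n) @[n --> \oo] --> trivial_density F).
Proof.
exists empty_graph; split.
  by apply/cvgnyPge => A; near=> n; apply: leqW; near: n; exact: nbhs_infty_ge.
by move=> F; under eq_cvg do rewrite hom_density_empty; exact: cvg_cst.
Unshelve. all: by end_near. Qed.

Definition trivial_limit : graph_limit R := GraphLimit trivial_densityP.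

End TrivialLimit.

Section DirectSumOfLimits.
Variables (R : realType) (I : choiceType).
Variables (alpha : I -> R) (Gamma : I -> graph_limit R).

Definition is_direct_sum (L : graph_limit R) : Prop :=
  forall F : graph, connected_graph F -> has_edge F ->
    ((L F)%:E = \esum_(i in [set: I]) (alpha i ^+ nverts F * Gamma i F)%:E)%E.

(* The unique graph limit with the densities above; the default value
   trivial_limit would only be used if there were none. *)
Definition direct_sum : graph_limit R :=
  xget (trivial_limit R) [set L | is_direct_sum L].

End DirectSumOfLimits.

Record prob_space (R : realType) := ProbSpace {
  space_disp : measure_display;
  space_sort :> measurableType space_disp;
  space_prob : probability space_sort R }.

Section PowerMeasure.
Context d (T : measurableType d) (R : realType) (P : probability T R).

Definition tuple_cons n (x : T * n.-tuple T) : n.+1.-tuple T :=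
  [tuple of x.1 :: x.2].

Lemma measurable_tuple_cons n : measurable_fun setT (@tuple_cons n).
Proof. exact: measurable_cons. Qed.

HB.instance Definition _ n :=
  isMeasurableFun.Build _ _ _ _ (@tuple_cons n) (@measurable_tuple_cons n).

Section Step.
Variables (n : nat) (Q : probability (n.-tuple T) R).

Definition power_step : set (n.+1.-tuple T) -> \bar R :=
  pushforward (P \x Q)%E (@tuple_cons n).

Let power_step0 : power_step set0 = 0%E.
Proof. by rewrite /power_step /pushforward preimage_set0 measure0. Qed.

Let power_step_ge0 A : (0 <= power_step A)%E.
Proof. exact: measure_ge0. Qed.

Let mpre (A : set (n.+1.-tuple T)) :
  measurable A -> measurable (@tuple_cons n @^-1` A).
Proof.
by move=> mA; rewrite -[X in measurable X]setTI; exact: measurable_tuple_cons.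
Qed.

Let power_step_sigma_additive : semi_sigma_additive power_step.
Proof.
move=> F mF tF mUF; rewrite /power_step /pushforward preimage_bigcup.
apply: measure_semi_sigma_additive.
- by move=> k; exact: mpre.
- apply/trivIsetP => /= i j _ _ ij; rewrite -preimage_setI.
  by move/trivIsetP : tF => /(_ _ _ _ _ ij) ->//; rewrite preimage_set0.
- by rewrite -preimage_bigcup; exact: mpre.
Qed.

HB.instance Definition _ := isMeasure.Build _ _ _ power_step
  power_step0 power_step_ge0 power_step_sigma_additive.

Let power_stepT : power_step setT = 1%E.
Proof.
rewrite /power_step /pushforward preimage_setT -setXTT product_measure1E//.
by rewrite -[RHS]mule1; congr (_ * _)%E; exact: probability_setT.
Qed.

HB.instance Definition _ :=
  Measure_isProbability.Build _ _ _ power_step power_stepT.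

End Step.

(* The n-fold product measure on T^n. *)
Fixpoint power_prob (n : nat) : probability (n.-tuple T) R :=
  if n is n'.+1 then power_step (power_prob n')
  else dirac ([tuple] : 0.-tuple T).

End PowerMeasure.

Record graph_kernel (R : realType) (S : prob_space R) := GraphKernel {
  kernel_fun :> S -> S -> R;
  kernel_sym : forall x y, kernel_fun x y = kernel_fun y x;
  kernel_range : forall x y, 0 <= kernel_fun x y <= 1;
  kernel_meas : measurable_fun [set: S * S] (fun p => kernel_fun p.1 p.2) }.

Section Representation.
Variables (R : realType) (S : prob_space R).

(* Each edge contributes one factor: the product runs over the adjacent pairs
   in increasing order. *)
Definition kernel_density (W : graph_kernel S) (F : graph) : \bar R :=
  \int[power_prob (space_prob S) (nverts F)]_x
    (\prod_(p : 'I_(nverts F) * 'I_(nverts F) | (p.1 < p.2)%N && edge F p.1 p.2)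
       W (tnth x p.1) (tnth x p.2))%:E.

Definition represents (W : graph_kernel S) (Gamma : graph_limit R) : Prop :=
  forall F : graph, (Gamma F)%:E = kernel_density W F.

End Representation.

Record prob_weights (R : realType) (I : choiceType) := ProbWeights {
  weight :> I -> R;
  weight_ge0 : forall i, 0 <= weight i;
  weight_sum1 : (\esum_(i in [set: I]) (weight i)%:E = 1)%E }.

Section DisjointUnion.
Variables (R : realType) (I : countType) (a : prob_weights R I).
Variable S : I -> prob_space R.

(* The weights are a parameter because a measurableType is pointed, hence
   nonempty: they sum to 1, so there is at least one index. *)
Definition disjoint_union : Type := {i : I & S i}.

Lemma weights_index : exists i : I, True.
Proof.
apply: contrapT => noI.
have := weight_sum1 a; rewrite (_ : [set: I] = set0) ?esum_set0; last first.
  by rewrite -subset0 => i _; apply: noI; exists i.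
by move=> /esym/eqP; rewrite onee_eq0.
Qed.

Definition union_point : disjoint_union :=
  let i := projT1 (cid weights_index) in existT _ i (point : S i).

HB.instance Definition _ := Choice.copy disjoint_union {i : I & S i}.
HB.instance Definition _ := isPointed.Build disjoint_union union_point.

Definition inj_union (i : I) (x : S i) : disjoint_union := existT _ i x.

Definition union_measurable (A : set disjoint_union) : Prop :=
  forall i, measurable (inj_union (i := i) @^-1` A).

Lemma union_measurable0 : union_measurable set0.
Proof. by move=> i; rewrite preimage_set0. Qed.

Lemma union_measurableC A : union_measurable A -> union_measurable (~` A).
Proof. by move=> mA i; rewrite preimage_setC; exact: measurableC. Qed.

Lemma union_measurable_bigcup (F : (set disjoint_union)^nat) :
  (forall n, union_measurable (F n)) -> union_measurable (\bigcup_n F n).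
Proof.
by move=> mF i; rewrite preimage_bigcup; apply: bigcup_measurable => n _; exact: mF.
Qed.

HB.instance Definition _ := isMeasurable.Build default_measure_display
  disjoint_union union_measurable0 union_measurableC union_measurable_bigcup.

Lemma union_measurableE (A : set disjoint_union) :
  measurable A = union_measurable A.
Proof. by []. Qed.

Definition union_measure (A : set disjoint_union) : \bar R :=
  \esum_(i in [set: I])
    ((a i)%:E * space_prob (S i) (inj_union (i := i) @^-1` A))%E.

Let term_ge0 i A :
  (0 <= (a i)%:E * space_prob (S i) (inj_union (i := i) @^-1` A))%E.
Proof. by rewrite mule_ge0 ?lee_fin ?weight_ge0. Qed.

Let union_measure0 : union_measure set0 = 0%E.
Proof. by apply: esum1 => i _; rewrite preimage_set0 measure0 mule0. Qed.

Let union_measure_ge0 A : (0 <= union_measure A)%E.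
Proof. by apply: esum_ge0 => i _; exact: term_ge0. Qed.

Let union_measure_sigma_additive : semi_sigma_additive union_measure.
Proof.
move=> F mF tF mUF.
rewrite [X in _ --> X](_ : _ = \sum_(n <oo) union_measure (F n))%E; last first.
  rewrite nneseries_esumT//.
  rewrite [RHS](@esum_esum _ _ _ setT (fun=> setT)
    (fun n i => (a i)%:E * space_prob (S i) (inj_union (i := i) @^-1` F n))%E)//.
  transitivity (\esum_(i in [set: I]) \esum_(n in [set: nat])
    ((a i)%:E * space_prob (S i) (inj_union (i := i) @^-1` F n)))%E.
    apply: eq_esum => i _; rewrite -nneseries_esumT// nneseriesZl//.
    congr (_ * _)%E; rewrite preimage_bigcup; apply: measure_semi_bigcup.
    - by move=> n; exact: mF.
    - apply/trivIsetP => /= j k _ _ jk; rewrite -preimage_setI.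
      by move/trivIsetP : tF => /(_ _ _ _ _ jk) ->//; rewrite preimage_set0.
    - by have := mUF i; rewrite preimage_bigcup.
  rewrite (@esum_esum _ _ _ setT (fun=> setT))//.
  rewrite (reindex_esum (setT `*`` (fun=> setT)) _
    (fun x : I * nat => (x.2, x.1)))//; split=> //=.
    by move=> [i1 i2] [j1 j2] /= _ _ [] -> ->.
  by move=> [i1 i2] _ /=; exists (i2, i1).
by apply/cvg_closeP; split; [exact: is_cvg_nneseries|rewrite closeE].
Qed.

HB.instance Definition _ := isMeasure.Build _ _ _ union_measure
  union_measure0 union_measure_ge0 union_measure_sigma_additive.

Let union_measureT : union_measure setT = 1%E.
Proof.
rewrite -(weight_sum1 a); apply: eq_esum => i _.
by rewrite preimage_setT probability_setT mule1.
Qed.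

HB.instance Definition _ :=
  Measure_isProbability.Build _ _ _ union_measure union_measureT.

Definition union_space : prob_space R := ProbSpace union_measure.

Variable W : forall i, graph_kernel (S i).

(* If tag u = tag v, then tagged_as u v is tagged v, cast to S (tag u). *)
Definition union_kernel_fun (u v : union_space) : R :=
  if tag u == tag v then W (tag u) (tagged u) (tagged_as u v) else 0.

Lemma union_kernel_sym u v : union_kernel_fun u v = union_kernel_fun v u.
Proof.
rewrite /union_kernel_fun eq_sym; case: eqP => //.
case: u v => [i x] [j y] /= ji; case: _ / ji x => x.
by rewrite !tagged_asE kernel_sym.
Qed.

Lemma union_kernel_range u v : 0 <= union_kernel_fun u v <= 1.
Proof. by rewrite /union_kernel_fun; case: ifP => _; [exact: kernel_range|rewrite lexx ler01]. Qed.

Definition union_retract i (u : union_space) : S i :=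
  tagged_as (inj_union (point : S i)) u.

Lemma measurable_union_retract i : measurable_fun setT (union_retract i).
Proof.
move=> _ B mB; rewrite setTI /= union_measurableE => j.
have [ij|ij] := eqVneq i j.
  case: _ / ij => //.
  rewrite (_ : _ @^-1` _ = B)//; apply/seteqP.
  by split=> x; rewrite /preimage /= /union_retract /inj_union tagged_asE.
rewrite (_ : inj_union (i := j) @^-1` _ = [set x | B point]).
  have [Bp|Bp] := pselect (B point).
    by rewrite (_ : mkset _ = setT)//; apply/seteqP; split.
  by rewrite (_ : mkset _ = set0)//; apply/seteqP; split.
apply/seteqP; split=> x; rewrite /preimage /= /union_retract /tagged_as /=;
  by case: eqP => // e; case/eqP: ij.
Qed.

Lemma measurable_tag i : measurable [set u : union_space | tag u = i].
Proof.
rewrite /= union_measurableE => j; have [ij|ij] := eqVneq j i.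
  by rewrite (_ : _ @^-1` _ = setT)//; apply/seteqP; split.
rewrite (_ : _ @^-1` _ = set0)//; apply/seteqP; split => // x /= /eqP.
by rewrite (negbTE ij).
Qed.

Lemma union_kernel_meas : measurable_fun [set: union_space * union_space]
  (fun p => union_kernel_fun p.1 p.2).
Proof.
have mD i : measurable [set p : union_space * union_space | tag p.1 = i].
  rewrite (_ : mkset _ = [set u : union_space | tag u = i] `*` setT).
    by apply: measurableX => //; exact: measurable_tag.
  by apply/seteqP; split=> p //= -[].
have mE i : measurable [set p : union_space * union_space | tag p.2 = i].
  rewrite (_ : mkset _ = setT `*` [set u : union_space | tag u = i]).
    by apply: measurableX => //; exact: measurable_tag.
  by apply/seteqP; split=> p //= -[].
move=> _ B mB; rewrite setTI.
rewrite (_ : _ @^-1` B = \bigcup_(i : I)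
    (([set p | tag p.1 = i] `&` [set p | tag p.2 = i] `&`
      (fun p => W i (union_retract i p.1) (union_retract i p.2)) @^-1` B) `|`
     ([set p | tag p.1 = i] `&` ~` [set p | tag p.2 = i] `&` [set _ | B 0]))).
  apply: countable_bigcupT_measurable => // i; apply: measurableU.
    apply: measurableI; first exact: measurableI.
    rewrite -[X in measurable X]setTI.
    suff : measurable_fun setT (fun p : union_space * union_space =>
      W i (union_retract i p.1) (union_retract i p.2)) by apply.
    pose h (p : union_space * union_space) :=
      (union_retract i p.1, union_retract i p.2).
    apply: (@measurableT_comp _ _ _ _ _ _ (fun q => W i q.1 q.2) _ h).
      exact: kernel_meas.
    apply/measurable_fun_pairP; split.
      exact: (measurableT_comp (@measurable_union_retract i) measurable_fst).
    exact: (measurableT_comp (@measurable_union_retract i) measurable_snd).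
  apply: measurableI; first by apply: measurableI => //; exact: measurableC.
  have [B0|B0] := pselect (B 0).
    by rewrite (_ : mkset _ = setT)//; apply/seteqP; split.
  by rewrite (_ : mkset _ = set0)//; apply/seteqP; split.
have E (p : union_space * union_space) : tag p.2 = tag p.1 ->
    union_kernel_fun p.1 p.2 =
    W (tag p.1) (union_retract (tag p.1) p.1) (union_retract (tag p.1) p.2).
  case: p => -[i x] [j y] /= ij; case: _ / (esym ij) y => y.
  by rewrite /union_kernel_fun /union_retract /= eqxx !tagged_asE.
apply/seteqP; split => p /=.
  move=> Bp; exists (tag p.1) => //.
  have [tp|tp] := eqVneq (tag p.2) (tag p.1).
    by left; split => //=; rewrite -E.
  right; split => //=; first by split => //; apply/eqP.
  by move: Bp; rewrite /union_kernel_fun; case: eqP => // e; case/eqP: tp.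
move=> [i _ [[[/= p1 p2] Bp]|[[/= p1 p2] Bp]]].
  by rewrite E ?p1 ?p2.
rewrite /union_kernel_fun; case: eqP => // e; by case: p2; rewrite -e p1.
Qed.

Definition union_kernel : graph_kernel union_space :=
  GraphKernel union_kernel_sym union_kernel_range union_kernel_meas.

End DisjointUnion.

Section Filler.
Variables (R : realType) (I : countType) (alpha : I -> R).
Hypothesis alpha_ge0 : forall i, 0 <= alpha i.
Hypothesis alpha_le1 : (\esum_(i in [set: I]) (alpha i)%:E <= 1)%E.

(* None is the additional index, carrying the zero kernel. *)
Definition fill_weight (o : option I) : R :=
  if o is Some i then alpha i
  else 1 - fine (\esum_(i in [set: I]) (alpha i)%:E)%E.

Let esum_fin : (\esum_(i in [set: I]) (alpha i)%:E \is a fin_num)%E.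
Proof.
rewrite ge0_fin_numE; first exact: le_lt_trans alpha_le1 (ltry _).
by apply: esum_ge0 => i _; rewrite lee_fin.
Qed.

Lemma fill_weight_ge0 o : 0 <= fill_weight o.
Proof.
by case: o => [i|] //=; rewrite subr_ge0 -lee_fin fineK.
Qed.

Lemma fill_weight_sum1 :
  (\esum_(o in [set: option I]) (fill_weight o)%:E = 1)%E.
Proof.
rewrite (esumID [set None]); last first.
  by move=> o _; rewrite lee_fin fill_weight_ge0.
rewrite setTI esum_set1; last by rewrite lee_fin fill_weight_ge0.
rewrite (reindex_esum [set: I] _ Some); last first.
  split; first by [].
  - by move=> i j _ _ [].
  - by move=> [i|] [_ /= H] //; exists i.
by rewrite /= EFinB fineK// subeK.
Qed.

Definition fill_weights : prob_weights R (option I) :=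
  ProbWeights fill_weight_ge0 fill_weight_sum1.

End Filler.

Section FillKernels.
Variables (R : realType) (I : Type).

Definition fill_space (S0 : prob_space R) (S : I -> prob_space R)
    (o : option I) : prob_space R :=
  if o is Some i then S i else S0.

Lemma zero_kernel_meas (S0 : prob_space R) :
  measurable_fun [set: S0 * S0] (fun=> 0 : R).
Proof. exact: measurable_cst. Qed.

Definition zero_kernel (S0 : prob_space R) : graph_kernel S0.
Proof.
refine (@GraphKernel R S0 (fun _ _ => 0) _ _ (@zero_kernel_meas S0)) => //.
by move=> x y; rewrite lexx ler01.
Defined.

Definition fill_kernel (S0 : prob_space R) (S : I -> prob_space R)
    (W : forall i, graph_kernel (S i)) (o : option I) :
    graph_kernel (fill_space S0 S o) :=
  match o with Some i => W i | None => zero_kernel S0 end.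

End FillKernels.

(* The index set of a sequence of length m, where None stands for infinity
   and the indices start at 0. *)
Definition index_bound (m : option nat) (i : nat) : bool :=
  if m is Some k then (i < k)%N else true.

Definition idx (m : option nat) : Type := {i : nat | index_bound m i}.

HB.instance Definition _ (m : option nat) :=
  Countable.copy (idx m) {i : nat | index_bound m i}.

(* Main.v *)
Require Import Defs.
From HB Require Import structures.
From mathcomp Require Import all_boot all_order all_algebra.
From mathcomp Require Import all_classical all_reals all_analysis.
From mathcomp Require Import measurable_realfun zify.

(** A graph invariant is called split multiplicative here if it is 1 on the
    one-vertex graph and takes the product of its values on two parts whenever
    the vertices are split into two parts with no edge in between.  Peeling off
    connected components ([graph_split_ind]), such an invariant is determined
    by its values on the connected graphs that have an edge
    ([split_multiplicative_eq]).  Homomorphism densities are split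
    multiplicative, hence so are graph limits; kernel densities are too, by
    Fubini, since the variables attached to the two parts are independent
    ([kernel_density_multiplicative]).

    For a connected graph F with k vertices, the edge product of a direct sum
    of kernels vanishes unless all k points fall into the same summand.  Points
    of the i-th summand have total mass alpha_i, so the density of F is the sum
    of alpha_i ^ k * t(F, Gamma_i) ([kernel_density_union]).  This is the
    defining property of the direct sum of the graph limits, so the two agree
    on connected graphs with an edge, and then on all graphs.

    It remains to see that the direct sum of the graph limits exists at all,
    that is, that its densities are limits of densities of finite graphs.  Take
    graphs G_(i, n) converging to Gamma_i, and let H_n be the disjoint union,
    over i < n, of a blow-up of G_(i, n) having about alpha_i N_n vertices,
    completed by isolated vertices to N_n vertices in all
    ([direct_sum_sequence]).  Blow-ups do not change densities, so for
    connected F the density in H_n is a sum over i dominated by alpha_i, which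
    converges to the required sum.  By multiplicativity the densities of all
    other graphs in H_n converge as well, to the kernel densities
    ([union_kernel_limitP]).

    If the weights add up to less than 1, the filler is one more summand: a
    zero kernel, which represents the trivial graph limit and contributes
    nothing to the defining property of the direct sum. *)

Set Implicit Arguments.
Unset Strict Implicit.
Unset Printing Implicit Defensive.

Import Order.TTheory GRing.Theory Num.Theory.
Import numFieldNormedType.Exports.

Local Open Scope classical_set_scope.
Local Open Scope ring_scope.

(** * Product measures on tuples *)

Section PowerMeasureTheory.
Context d (T : measurableType d) (R : realType) (P : probability T R).

Definition box n (A : 'I_n -> set T) : set (n.-tuple T) :=
  [set x | forall i, A i (tnth x i)].

Lemma measurable_box n (A : 'I_n -> set T) :
  (forall i, measurable (A i)) -> measurable (box A).
Proof.
move=> mA; rewrite (_ : box A = \bigcap_i ((fun x => tnth x i) @^-1` A i)).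
  apply: fin_bigcap_measurable => // i _; rewrite -[X in measurable X]setTI.
  exact: measurable_tnth.
by apply/seteqP; split=> x Ax i; [move=> _; exact: Ax|exact: (Ax i)].
Qed.

(** Boxes are stable under intersection and generate the product sigma-algebra. *)
Lemma tuple_measure_unique n (m1 m2 : {measure set (n.-tuple T) -> \bar R}) :
  (m1 setT < +oo)%E ->
  (forall A, (forall i, measurable (A i)) -> m1 (box A) = m2 (box A)) ->
  forall B, measurable B -> m1 B = m2 B.
Proof.
move=> m1oo m12.
apply: (measure_unique
  [set box A | A in [set A : 'I_n -> set T | forall i, measurable (A i)]]
  (fun=> setT)) => //.
- apply/seteqP; split.
    apply: smallest_sub; first exact: smallest_sigma_algebra.
    move=> B; case: n B m1 m2 m1oo m12 => [|n] B _ _ _ _.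
      by rewrite big_ord0.
    rewrite -bigcup_mkord_ord => -[i Ii [A mA <-]].
    apply: sub_sigma_algebra => /=.
    (* A coordinate preimage is a box with all other sides full. *)
    exists (fun j => if j == inord i then A else setT).
      by move=> j; case: ifP.
    apply/seteqP; split=> x /=.
      by move=> /(_ (inord i)); rewrite eqxx.
    by move=> [_ Ax] j; case: eqP => // ->.
  apply: smallest_sub; first exact: sigma_algebra_measurable.
  by move=> _ [A mA <-]; exact: measurable_box.
- move=> _ _ [A mA <-] [B mB <-]; exists (fun i => A i `&` B i).
    by move=> i; exact: measurableI.
  apply/seteqP; split=> x /=; first by move=> AB; split=> i; case: (AB i).
  by move=> [HA HB] i; split.
- move=> _; exists (fun=> setT) => //.
  by apply/seteqP; split.
- by apply/seteqP; split=> // x _; exists 0%N.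
- by move=> _ [A mA <-]; exact: m12.
Qed.

Lemma power_prob_box n (A : 'I_n -> set T) : (forall i, measurable (A i)) ->
  power_prob P n (box A) = (\prod_(i < n) P (A i))%E.
Proof.
elim: n A => [|n IH] A mA.
  rewrite big_ord0 /= diracE mem_set//.
  by case.
rewrite big_ord_recl /= /power_step /pushforward.
rewrite (_ : _ @^-1` _ = A ord0 `*` box (A \o lift ord0)); last first.
  apply/seteqP; split=> -[x y] /=.
    move=> Axy; split; first exact: (Axy ord0).
    by move=> i; have := Axy (lift ord0 i); rewrite /tuple_cons /= tnthS.
  move=> [Ax Ay] i; case: (unliftP ord0 i) => [j|] ->; last by [].
  by rewrite /tuple_cons tnthS; exact: Ay.
rewrite product_measure1E//; last by apply: measurable_box => i; exact: mA.
congr (_ * _)%E; exact: IH (A \o lift ord0) (fun i => mA (lift ord0 i)).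
Qed.

(** Tonelli, with the first coordinate singled out: the form that suits
    inductions on the number of coordinates. *)
Lemma integral_power_probS n (f : n.+1.-tuple T -> \bar R) :
  measurable_fun [set: n.+1.-tuple T] f -> (forall x, 0 <= f x)%E ->
  (\int[power_prob P n.+1]_x f x =
   \int[P]_x \int[power_prob P n]_y f (tuple_cons (x, y)))%E.
Proof.
move=> mf f0; rewrite [LHS](@ge0_integral_pushforward _ _ _ _ _ _
  (@measurable_tuple_cons _ _ _))//= preimage_setT.
rewrite fubini_tonelli1//=.
by apply: measurableT_comp => //; exact: measurable_tuple_cons.
Qed.

(** A bijection of 'I_k + 'I_l with 'I_n distributes n coordinates over two
    groups.  Assembling a point from independent k- and l-tuples preserves the
    product measure, because it does so on boxes. *)
Section Merge.
Variables (n k l : nat) (theta : 'I_k + 'I_l -> 'I_n).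
Variable split_idx : 'I_n -> 'I_k + 'I_l.
Hypotheses (thetaK : cancel theta split_idx) (splitK : cancel split_idx theta).

Definition merge (yz : k.-tuple T * l.-tuple T) : n.-tuple T :=
  [tuple match split_idx i with
         | inl a => tnth yz.1 a | inr b => tnth yz.2 b end | i < n].

Lemma tnth_mergel yz a : tnth (merge yz) (theta (inl a)) = tnth yz.1 a.
Proof. by rewrite tnth_mktuple thetaK. Qed.

Lemma tnth_merger yz b : tnth (merge yz) (theta (inr b)) = tnth yz.2 b.
Proof. by rewrite tnth_mktuple thetaK. Qed.

Lemma measurable_merge : measurable_fun setT merge.
Proof.
apply/measurable_fun_tnthP => i; rewrite /comp.
under eq_fun do rewrite tnth_mktuple.
case: (split_idx i) => [a|b].
  exact: (measurableT_comp (@measurable_tnth _ _ _ a) measurable_fst).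
exact: (measurableT_comp (@measurable_tnth _ _ _ b) measurable_snd).
Qed.

HB.instance Definition _ := isMeasurableFun.Build _ _ _ _ merge measurable_merge.

Lemma power_prob_merge B : measurable B ->
  power_prob P n B = pushforward (power_prob P k \x power_prob P l)%E merge B.
Proof.
apply: (@tuple_measure_unique n (power_prob P n)
  (pushforward (power_prob P k \x power_prob P l)%E merge)).
  by rewrite [ltLHS](probability_setT (power_prob P n)) ltry.
move=> A mA; apply: etrans (power_prob_box mA) _; rewrite /= /pushforward.
rewrite (_ : _ @^-1` _ = box (A \o theta \o inl) `*` box (A \o theta \o inr)).
  rewrite product_measure1E; try by apply: measurable_box => i; exact: mA.
  rewrite [X in (_ = X * _)%E]power_prob_box; last by move=> i; exact: mA.
  rewrite [X in (_ = _ * X)%E]power_prob_box; last by move=> i; exact: mA.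
  rewrite (reindex theta); last by exists split_idx => ? _.
  by rewrite big_sumType.
apply/seteqP; split=> -[y z] /=.
  move=> Ayz; split=> i /=.
    by have := Ayz (theta (inl i)); rewrite tnth_mergel.
  by have := Ayz (theta (inr i)); rewrite tnth_merger.
move=> [Ay Az] i; rewrite -(splitK i); case: (split_idx i) => [a|b].
  by rewrite tnth_mergel; exact: Ay.
by rewrite tnth_merger; exact: Az.
Qed.

Lemma integral_power_prob_merge (f : n.-tuple T -> \bar R)
    (g : k.-tuple T -> \bar R) (h : l.-tuple T -> \bar R) :
  measurable_fun [set: n.-tuple T] f ->
  measurable_fun [set: k.-tuple T] g ->
  measurable_fun [set: l.-tuple T] h ->
  (forall x, 0 <= g x)%E -> (forall x, 0 <= h x)%E ->
  (forall y z, f (merge (y, z)) = g y * h z)%E ->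
  (\int[power_prob P n]_x f x =
   \int[power_prob P k]_y g y * \int[power_prob P l]_z h z)%E.
Proof.
move=> mf mg mh g0 h0 fgh.
have f0 x : (0 <= f (merge x))%E by case: x => y z; rewrite fgh mule_ge0.
rewrite (eq_measure_integral
  (pushforward (power_prob P k \x power_prob P l)%E merge)); last first.
  by move=> B mB _; exact: power_prob_merge.
rewrite ge0_integral_pushforward//; last first.
  move=> x _; pose y := [tuple tnth x (theta (inl i)) | i < k].
  pose z := [tuple tnth x (theta (inr i)) | i < l].
  rewrite (_ : x = merge (y, z)) //; apply: eq_from_tnth => i.
  rewrite -(splitK i); case: (split_idx i) => [a|b].
    by rewrite tnth_mergel tnth_mktuple.
  by rewrite tnth_merger tnth_mktuple.
rewrite preimage_setT fubini_tonelli1//; last first.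
  by apply: measurableT_comp => //; exact: measurable_merge.
rewrite /fubini_F.
under eq_integral do under eq_integral do rewrite /= fgh.
under eq_integral do rewrite ge0_integralZl//.
by rewrite ge0_integralZr//; exact: integral_ge0.
Qed.

End Merge.

End PowerMeasureTheory.

(** * Splitting a graph into components *)

Section InducedSubgraph.
Variables (F : graph) (A : {set 'I_(nverts F)}).
Hypothesis A0 : A != finset.set0.

Let card_gt0A : (0 < #|A|)%N.
Proof. by rewrite card_gt0. Qed.

Let induced_sym :
  symmetric (fun a b : 'I_#|A| => edge F (enum_val a) (enum_val b)).
Proof. by move=> a b; exact: edge_sym. Qed.

Let induced_irr :
  irreflexive (fun a b : 'I_#|A| => edge F (enum_val a) (enum_val b)).
Proof. by move=> a; exact: edge_irr. Qed.

Definition induced : graph := Graph card_gt0A induced_sym induced_irr.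

End InducedSubgraph.

Section SplitIndices.
Variables (n : nat) (A : {set 'I_n}).

Definition join_idx (s : 'I_#|A| + 'I_#|~: A|) : 'I_n :=
  match s with inl a => enum_val a | inr b => enum_val b end.

Lemma join_idx_in s : (join_idx s \in A) = if s is inl _ then true else false.
Proof.
case: s => [a|b] /=; first exact: enum_valP.
by have := enum_valP b; rewrite inE => /negbTE.
Qed.

Lemma join_idx_bij : bijective join_idx.
Proof.
apply: inj_card_bij; last by rewrite card_sum !card_ord cardsC card_ord.
move=> s t st; have := join_idx_in s; rewrite st join_idx_in.
by case: s t st => [a|b] [a'|b'] //= /enum_val_inj ->.
Qed.

(** The enumeration of a set of ordinals is increasing, so the condition
    p.1 < p.2 on the pairs indexing an edge product survives the passage to an
    induced subgraph. *)
Lemma ltn_enum_val (a b : 'I_#|A|) : ((enum_val a < enum_val b) = (a < b))%N.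
Proof.
have srt : sorted (relpre val ltn) (enum A).
  rewrite /enum_mem -enumT; apply: sorted_filter.
    by move=> ? ? ?; exact: ltn_trans.
  by rewrite -sorted_map val_enum_ord iota_ltn_sorted.
have mono (i j : 'I_#|A|) : (i < j)%N -> (enum_val i < enum_val j)%N.
  move=> ij; pose x0 := enum_val i; rewrite !(enum_val_nth x0).
  apply: (sorted_ltn_nth (leT := relpre val ltn)) => //; rewrite ?inE -?cardE//.
  by move=> ? ? ?; exact: ltn_trans.
case: (ltngtP a b) => [/mono ->//|/mono|/val_inj ->]; last by rewrite ltnn.
by move=> ba; apply/negbTE; rewrite -leqNgt ltnW.
Qed.

End SplitIndices.

Definition edge_closed (F : graph) (A : {set 'I_(nverts F)}) : Prop :=
  forall x y, edge F x y -> (x \in A) = (y \in A).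

(** A graph which is not connected splits into the component of a vertex and
    the rest; a connected graph without edges has a single vertex. *)
Lemma graph_split_ind (P : graph -> Prop) :
  (forall F, connected_graph F -> has_edge F -> P F) ->
  (forall F, nverts F = 1%N -> P F) ->
  (forall F (A : {set 'I_(nverts F)})
      (A0 : A != finset.set0) (A0' : ~: A != finset.set0),
    @edge_closed F A -> P (induced A0) -> P (induced A0') -> P F) ->
  forall F, P F.
Proof.
move=> Pconn P1 Psplit F; have [n] := ubnP (nverts F).
elim: n F => // n IH F Fn.
have [Fc|] := pselect (connected_graph F).
  have [Fe|nFe] := pselect (has_edge F); first exact: Pconn.
  apply: P1; apply/eqP; rewrite eqn_leq nverts_gt0 andbT leqNgt; apply/negP => F1.
  pose x := Ordinal (nverts_gt0 F); pose y := Ordinal F1.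
  have /connectP[[|z p] /=] := Fc x y; first by move=> _ /(congr1 val).
  by move=> /andP[xz _] _; apply: nFe; exists x, z.
move=> /existsNP[x /existsNP[y nxy]].
pose A : {set _} := [set z | connect (edge F) x z]%SET.
have xA : x \in A by rewrite inE connect0.
have yA : y \in ~: A by rewrite !inE; apply/negP.
have A0 : A != finset.set0 by apply/set0Pn; exists x.
have A0' : ~: A != finset.set0 by apply/set0Pn; exists y.
have cards := cardsC A; rewrite card_ord in cards.
have A_gt0 : (0 < #|A|)%N by rewrite card_gt0.
have A'_gt0 : (0 < #|~: A|)%N by rewrite card_gt0.
apply: (Psplit F A A0 A0').
- move=> u v uv; rewrite !inE; apply/idP/idP => H; apply: (connect_trans H).
    exact: connect1.
  by apply: connect1; rewrite edge_sym.
- apply: IH => /=; rewrite ltnS in Fn; apply: leq_trans Fn.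
  by rewrite -[X in (_ < X)%N]cards -[ltnLHS]addn0 ltn_add2l.
- apply: IH => /=; rewrite ltnS in Fn; apply: leq_trans Fn.
  by rewrite -[X in (_ < X)%N]cards -[ltnLHS]add0n ltn_add2r.
Qed.

Section Multiplicative.
Variable R : realType.

Definition split_multiplicative (f : graph -> R) : Prop :=
  (forall F, nverts F = 1%N -> f F = 1) /\
  (forall F (A : {set 'I_(nverts F)})
      (A0 : A != finset.set0) (A0' : ~: A != finset.set0),
    @edge_closed F A -> f F = f (induced A0) * f (induced A0')).

(** Convergence need only be checked on connected graphs with an edge, since
    products of convergent sequences converge. *)
Lemma split_multiplicative_cvg (f : nat -> graph -> R) (g : graph -> R) :
  (forall n, split_multiplicative (f n)) -> split_multiplicative g ->
  (forall F, connected_graph F -> has_edge F -> f n F @[n --> \oo] --> g F) ->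
  forall F, f n F @[n --> \oo] --> g F.
Proof.
move=> fm gm fg; apply: graph_split_ind => //.
  move=> F F1; under eq_cvg do rewrite (fm _).1//.
  by rewrite gm.1//; exact: cvg_cst.
move=> F A A0 A0' cA IA IA'; rewrite (gm.2 F A A0 A0')//.
by under eq_cvg do rewrite ((fm _).2 F A A0 A0')//; exact: cvgM.
Qed.

Lemma split_multiplicative_eq (f g : graph -> R) :
  split_multiplicative f -> split_multiplicative g ->
  (forall F, connected_graph F -> has_edge F -> f F = g F) -> f =1 g.
Proof.
move=> fm gm fg; apply: graph_split_ind => //.
  by move=> F F1; rewrite fm.1// gm.1.
by move=> F A A0 A0' cA IA IA'; rewrite (fm.2 F A A0 A0')// IA IA' -gm.2.
Qed.

(** As no edge crosses the partition, a pair of homomorphisms on the two parts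
    is the same as one homomorphism on F. *)
Lemma card_hom_split F (A : {set 'I_(nverts F)})
    (A0 : A != finset.set0) (A0' : ~: A != finset.set0) G :
  @edge_closed F A ->
  #|[pred f | @is_hom F G f]| =
  (#|[pred f | @is_hom (induced A0) G f]| *
   #|[pred f | @is_hom (induced A0') G f]|)%N.
Proof.
move=> cA; have [spl joinK splK] := join_idx_bij A.
pose M (gh : {ffun 'I_#|A| -> 'I_(nverts G)} * {ffun 'I_#|~: A| -> 'I_(nverts G)})
  : {ffun 'I_(nverts F) -> 'I_(nverts G)} :=
  [ffun x => match spl x with inl a => gh.1 a | inr b => gh.2 b end].
have M_join gh s : M gh (join_idx s) =
    match s with inl a => gh.1 a | inr b => gh.2 b end.
  by rewrite ffunE joinK.
have bM : bijective M.
  pose N (f : {ffun 'I_(nverts F) -> 'I_(nverts G)}) :=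
    ([ffun a : 'I_#|A| => f (join_idx (inl a))],
     [ffun b : 'I_#|~: A| => f (join_idx (inr b))]).
  exists N.
    move=> [g h]; congr (_, _); apply/ffunP => a; rewrite ffunE.
      exact: (M_join (g, h) (inl a)).
    exact: (M_join (g, h) (inr a)).
  move=> f; apply/ffunP => x; rewrite -(splK x) M_join.
  by case: (spl x) => a; rewrite ffunE.
rewrite -sum1_card (reindex M); last exact: onW_bij.
transitivity (\sum_(gh | @is_hom (induced A0) G gh.1 &&
                         @is_hom (induced A0') G gh.2) 1)%N.
  apply: eq_bigl => -[g h]; rewrite inE /=; apply/forallP/andP => [H|[Hg Hh] x].
    split; apply/forallP => a; apply/forallP => b.
      by have /forallP/(_ (join_idx (inl b))) := H (join_idx (inl a));
        rewrite !M_join.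
    by have /forallP/(_ (join_idx (inr b))) := H (join_idx (inr a));
      rewrite !M_join.
  apply/forallP => y; apply/implyP => xy.
  have := cA _ _ xy; move: xy; rewrite -(splK x) -(splK y) !join_idx_in !M_join.
  case: (spl x) (spl y) => [a|a] [b|b] //= ab _.
    by have /forallP/(_ a)/forallP/(_ b)/implyP := Hg; exact.
  by have /forallP/(_ a)/forallP/(_ b)/implyP := Hh; exact.
rewrite -(pair_big (fun g => @is_hom (induced A0) G g)
  (fun h => @is_hom (induced A0') G h) (fun _ _ => 1%N)) /=.
rewrite -sum_nat_const; apply: eq_big => [g|g _]; rewrite ?inE//.
by rewrite sum1_card; apply: eq_card => h; rewrite !inE.
Qed.

Lemma hom_density_multiplicative (G : graph) :
  split_multiplicative (fun F => hom_density R F G).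
Proof.
split=> [F F1|F A A0 A0' cA]; rewrite /hom_density.
  rewrite (_ : #|[pred f | _]| = #|{ffun 'I_(nverts F) -> 'I_(nverts G)}|).
    rewrite divff// pnatr_eq0 -lt0n card_ffun !card_ord expn_gt0.
    by rewrite nverts_gt0.
  apply: eq_card => f; rewrite !inE; apply/forallP => x; apply/forallP => y.
  apply/implyP; rewrite (_ : y = x) ?edge_irr//.
  by apply/val_inj => /=; have := ltn_ord x; have := ltn_ord y; lia.
rewrite (card_hom_split A0 A0')// !card_ffun !card_ord natrM.
have -> : (nverts G ^ nverts F = nverts G ^ #|A| * nverts G ^ #|~: A|)%N.
  by rewrite -expnD cardsC card_ord.
by rewrite natrM invfM mulrACA.
Qed.

Lemma graph_limit_multiplicative (L : graph_limit R) : split_multiplicative L.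
Proof.
have [G [_ GL]] := limit_densityP L.
split=> [F F1|F A A0 A0' cA].
  have := GL F; under eq_cvg do rewrite (hom_density_multiplicative _).1//.
  by move=> /cvg_lim <-//; rewrite lim_cst.
have := GL F.
under eq_cvg do rewrite ((hom_density_multiplicative _).2 F A A0 A0')//.
by move=> /cvg_lim <-//; apply/cvg_lim => //; exact: cvgM.
Qed.

End Multiplicative.

(** * Multiplicativity of kernel densities *)

Lemma prod_enum_val_pairs (K : comPzSemiRingType) n (A : {set 'I_n}) (Q : rel 'I_n)
    (f : 'I_n -> 'I_n -> K) :
  \prod_(p : 'I_n * 'I_n | (p.1 \in A) && ((p.2 \in A) && Q p.1 p.2)) f p.1 p.2 =
  \prod_(p : 'I_#|A| * 'I_#|A| | Q (enum_val p.1) (enum_val p.2))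
    f (enum_val p.1) (enum_val p.2).
Proof.
rewrite -(pair_big_dep (fun i => i \in A) (fun i j => (j \in A) && Q i j) f).
rewrite big_enum_val.
rewrite -(pair_big_dep predT (fun a b => Q (enum_val a) (enum_val b))
  (fun a b => f (enum_val a) (enum_val b))).
by apply: eq_bigr => a _; rewrite big_enum_val_cond.
Qed.

Section KernelDensity.
Variables (R : realType) (S : prob_space R) (W : graph_kernel S).

Definition edge_product (F : graph) (x : (nverts F).-tuple S) : R :=
  \prod_(p : 'I_(nverts F) * 'I_(nverts F) | (p.1 < p.2)%N && edge F p.1 p.2)
    W (tnth x p.1) (tnth x p.2).

Lemma edge_product_ge0 F x : 0 <= @edge_product F x.
Proof.
apply: prodr_ge0 => p _.
by case/andP: (kernel_range W (tnth x p.1) (tnth x p.2)).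
Qed.

Lemma edge_product_le1 F x : @edge_product F x <= 1.
Proof. by apply: prodr_ile1 => p _; exact: kernel_range. Qed.

Lemma measurable_edge_product F :
  measurable_fun [set: (nverts F).-tuple S] (EFin \o @edge_product F).
Proof.
apply/measurable_EFinP; rewrite /edge_product.
under eq_fun do rewrite big_mkcond.
apply: measurable_prod => -[i j] _ /=;
case: (_ && _) => /=; last exact: measurable_cst.
pose h (x : (nverts F).-tuple S) := (tnth x i, tnth x j).
apply: (@measurableT_comp _ _ _ _ _ _ (fun q => W q.1 q.2) _ h).
  exact: kernel_meas.
by apply/measurable_fun_pairP; split; exact: measurable_tnth.
Qed.

Lemma kernel_density_fin_num F : kernel_density W F \is a fin_num.
Proof.
have k0 : (0 <= kernel_density W F)%E.
  by apply: integral_ge0 => x _; rewrite lee_fin; exact: edge_product_ge0.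
rewrite ge0_fin_numE//; apply: (@le_lt_trans _ _ 1%E); last exact: ltry.
have <- : (\int[power_prob (space_prob S) (nverts F)]_x (cst 1%E x) = 1)%E.
  by rewrite integral_cst// mul1e; exact: probability_setT.
apply: ge0_le_integral => //.
- by move=> x _; rewrite lee_fin; exact: edge_product_ge0.
- exact: measurable_edge_product.
- by move=> x _; rewrite lee_fin; exact: edge_product_le1.
Qed.

Lemma edge_product_split F (A : {set 'I_(nverts F)}) (A0 : A != finset.set0)
    (A0' : ~: A != finset.set0) (x : (nverts F).-tuple S)
    (y : #|A|.-tuple S) (z : #|~: A|.-tuple S) :
  edge_closed A ->
  (forall a, tnth x (enum_val a) = tnth y a) ->
  (forall b, tnth x (enum_val b) = tnth z b) ->
  @edge_product F x = @edge_product (induced A0) y * @edge_product (induced A0') z.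
Proof.
move=> cA xy xz; pose Q (i j : 'I_(nverts F)) := (i < j)%N && edge F i j.
pose f i j := W (tnth x i) (tnth x j).
have part (B : {set 'I_(nverts F)}) : edge_closed B ->
    \prod_(p : 'I_(nverts F) * 'I_(nverts F) | Q p.1 p.2 && (p.1 \in B)) f p.1 p.2 =
    \prod_(p : 'I_#|B| * 'I_#|B| |
            (p.1 < p.2)%N && edge F (enum_val p.1) (enum_val p.2))
      f (enum_val p.1) (enum_val p.2).
  move=> cB; under [RHS]eq_bigl do rewrite -ltn_enum_val.
  rewrite -(prod_enum_val_pairs B Q f); apply: eq_bigl => -[i j] /=.
  rewrite /Q; case ij: (edge F i j); last by rewrite !(andbF, andFb).
  by rewrite -(cB i j ij); case: (i \in B); rewrite ?andbF ?andbT.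
rewrite /edge_product (bigID (fun p => p.1 \in A)) /=; congr (_ * _).
  by rewrite part//; apply: eq_bigr => p _; rewrite /f !xy.
rewrite [LHS](_ : _ =
    \prod_(p | Q p.1 p.2 && (p.1 \in ~: A)) f p.1 p.2); last first.
  by apply: eq_bigl => p; rewrite inE.
rewrite part; first by apply: eq_bigr => p _; rewrite /f !xz.
by move=> i j ij; rewrite !inE (cA i j ij).
Qed.

(** The edge product factors into one function of the coordinates in A and one
    of the other coordinates. *)
Lemma kernel_density_multiplicative :
  split_multiplicative (fun F => fine (kernel_density W F)).
Proof.
split=> [F F1|F A A0 A0' cA].
  rewrite /kernel_density (eq_integral (cst 1%E)); last first.
    move=> x _; rewrite big_pred0// => -[i j] /=; apply/negbTE.
    by rewrite negb_and -leqNgt; have := ltn_ord i; have := ltn_ord j; lia.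
  by rewrite integral_cst// mul1e [X in fine X]probability_setT.
rewrite -fineM ?kernel_density_fin_num//; congr fine.
have [spl joinK splK] := join_idx_bij A.
apply: (integral_power_prob_merge (f := EFin \o @edge_product F)
    (g := EFin \o @edge_product (induced A0))
    (h := EFin \o @edge_product (induced A0')) _ joinK splK).
- exact: measurable_edge_product.
- exact: (@measurable_edge_product (induced A0)).
- exact: (@measurable_edge_product (induced A0')).
- by move=> x; rewrite lee_fin; exact: (@edge_product_ge0 (induced A0)).
- by move=> x; rewrite lee_fin; exact: (@edge_product_ge0 (induced A0')).
move=> y z /=; rewrite -EFinM; congr EFin; apply: edge_product_split => // a.
  exact: (tnth_mergel joinK (y, z) a).
exact: (tnth_merger joinK (y, z) a).
Qed.

End KernelDensity.

(** * Integration over a countable disjoint union *)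

Section EsumCountable.
Variables (R : realType) (I : countType).

(** Integrals against a countable family of measures are available for series
    over nat; this transports them to any countable index type, the numbers
    that encode no index contributing 0. *)
Lemma esum_pickle (f : I -> \bar R) : (forall i, 0 <= f i)%E ->
  (\esum_(i in [set: I]) f i = \sum_(n <oo) oapp f 0 (pickle_inv n : option I))%E.
Proof.
move=> f0; rewrite nneseries_esumT; last first.
  by move=> n; case: (pickle_inv n) => [i|]; [exact: f0|exact: lexx].
transitivity (\esum_(i in [set: I]) oapp f 0 (pickle_inv (pickle i) : option I))%E.
  by apply: eq_esum => i _; rewrite pickleK_inv.
rewrite -(@reindex_esum R I nat [set: I] (range (@pickle I)) (@pickle I)
    (fun n => oapp f 0 (pickle_inv n : option I))%E); last first.
  split; first exact: imageP.
  - by move=> i j _ _; apply: (pcan_inj pickleK).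
  - exact: subset_refl.
rewrite esum_mkcond; apply: eq_esum => n _; case: ifPn => // /negP nr.
case E : (pickle_inv n : option I) => [i|] //=; exfalso; apply: nr.
by rewrite inE; exists i => //; have := pickle_invK (T := I) n; rewrite /oapp E.
Qed.

Lemma esum_single (f : I -> \bar R) i : (forall j, 0 <= f j)%E ->
  (forall j, j != i -> f j = 0%E) -> (\esum_(j in [set: I]) f j = f i)%E.
Proof.
move=> f0 fz; rewrite (esumID [set i])// setTI esum_set1//.
rewrite [X in (_ + X)%E]esum1 ?adde0//.
by move=> j [_ /eqP]; exact: fz.
Qed.

End EsumCountable.

Section UnionIntegral.
Variables (R : realType) (I : countType) (a : prob_weights R I).
Variable S : I -> prob_space R.

Let U := union_space a S.
Let inj i (x : S i) : U := inj_union (S := S) x.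

Lemma measurable_inj_union i : measurable_fun [set: S i] (@inj i).
Proof. by move=> _ B mB; rewrite setTI; exact: mB. Qed.

Let inj_law i : {measure set U -> \bar R} :=
  measure_function_pushforward__canonical__measure_function_Measure
    (space_prob (S i)) (@measurable_inj_union i).

Let summand (o : option I) : {measure set U -> \bar R} :=
  if o is Some i then
    mscale (NngNum (weight_ge0 a i)) (inj_law i)
  else mzero.

(** The measure of the union is the series of the laws of the inclusions of the
    summands, scaled by the weights. *)
Lemma integral_union (g : U -> \bar R) :
  measurable_fun [set: U] g -> (forall u, 0 <= g u)%E ->
  (\int[space_prob U]_u g u =
   \esum_(i in [set: I]) ((a i)%:E * \int[space_prob (S i)]_x g (inj x)))%E.
Proof.
move=> mg g0; rewrite (eq_measure_integral
  (mseries (fun n => summand (pickle_inv n)) 0%N)); last first.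
  move=> A mA _; rewrite /= /union_measure esum_pickle; last first.
    by move=> i; rewrite mule_ge0// lee_fin weight_ge0.
  rewrite /mseries; apply: eq_eseriesr => n _.
  by case: (pickle_inv n : option I) => [i|].
rewrite ge0_integral_measure_series// esum_pickle; last first.
  by move=> i; rewrite mule_ge0// ?lee_fin ?weight_ge0//; exact: integral_ge0.
apply: eq_eseriesr => n _; case: (pickle_inv n : option I) => [i|] /=; last first.
  exact: integral_measure_zero.
rewrite ge0_integral_mscale//; congr (_ * _)%E.
by rewrite ge0_integral_pushforward//; exact: measurable_inj_union.
Qed.

End UnionIntegral.

Section UnionPower.
Variables (R : realType) (I : countType) (a : prob_weights R I).
Variable S : I -> prob_space R.

Let U := union_space a S.
Let inj i (x : S i) : U := inj_union (S := S) x.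
Let injs i n (y : n.-tuple (S i)) : n.-tuple U := map_tuple (@inj i) y.

Definition tags_are n (x : n.-tuple U) (i : I) : Prop :=
  forall k, tag (tnth x k) = i.

Lemma measurable_injs i n : measurable_fun [set: n.-tuple (S i)] (@injs i n).
Proof.
apply/measurable_fun_tnthP => k; rewrite /comp.
under eq_fun do rewrite tnth_map.
exact: (measurableT_comp (@measurable_inj_union _ _ a S i)
  (@measurable_tnth _ _ _ k)).
Qed.

Lemma injs_cons i n x (y : n.-tuple (S i)) :
  injs (tuple_cons (x, y)) = tuple_cons (inj x, injs y).
Proof. exact: val_inj. Qed.

Lemma tags_are_cons i n u (y : n.-tuple U) :
  tags_are (tuple_cons (u, y)) i -> tag u = i /\ tags_are y i.
Proof.
move=> uy; split; first exact: (uy ord0).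
by move=> k; have := uy (lift ord0 k); rewrite /tuple_cons tnthS.
Qed.

(** Common step of the next two integral computations: once the first point
    is known to lie in the i-th summand and the integrand forces the others to
    follow it, each of the n remaining points contributes a factor a i. *)
Lemma integral_inj_first n i (h : n.+1.-tuple U -> \bar R) :
  (forall h : n.-tuple U -> \bar R, measurable_fun [set: n.-tuple U] h ->
    (forall x, 0 <= h x)%E -> (forall x, ~ tags_are x i -> h x = 0%E) ->
    (\int[power_prob (space_prob U) n]_x h x =
     (a i ^+ n)%:E * \int[power_prob (space_prob (S i)) n]_y h (injs y))%E) ->
  measurable_fun [set: n.+1.-tuple U] h -> (forall x, 0 <= h x)%E ->
  (forall (x : S i) (y : n.-tuple U),
    ~ tags_are y i -> h (tuple_cons (inj x, y)) = 0%E) ->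
  ((a i)%:E * \int[space_prob (S i)]_x
      \int[power_prob (space_prob U) n]_y h (tuple_cons (@inj i x, y)) =
   (a i ^+ n.+1)%:E *
      \int[power_prob (space_prob (S i)) n.+1]_y h (injs y))%E.
Proof.
move=> IH mh h0 hz.
have mcons (x : S i) : measurable_fun [set: n.-tuple U]
    (fun y => h (tuple_cons (inj x, y))).
  apply: (measurableT_comp mh).
  apply: (measurableT_comp (@measurable_tuple_cons _ U n)).
  exact: measurable_pair1.
have mhinj : measurable_fun [set: n.+1.-tuple (S i)] (h \o @injs i n.+1).
  exact: (measurableT_comp mh (@measurable_injs i n.+1)).
have mF : measurable_fun [set: S i] (fun x =>
    \int[power_prob (space_prob (S i)) n]_y h (injs (tuple_cons (x, y))))%E.
  apply: (@measurable_fun_fubini_tonelli_F _ _ _ _ _ _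
    ((h \o @injs i n.+1) \o @tuple_cons _ (S i) n)) => //.
    by apply: (measurableT_comp mhinj); exact: measurable_tuple_cons.
  by move=> x; exact: h0.
rewrite [in RHS]integral_power_probS//.
rewrite exprS EFinM -muleA; congr (_ * _)%E.
under eq_integral do rewrite (IH _ (mcons _) (fun _ => h0 _) (hz _)).
rewrite ge0_integralZl//.
- congr (_ * _)%E; apply: eq_integral => x _; apply: eq_integral => y _.
  by rewrite injs_cons.
- by under eq_fun do under eq_integral do rewrite -injs_cons.
- by move=> x _; apply: integral_ge0 => y _; exact: h0.
- by rewrite lee_fin exprn_ge0// weight_ge0.
Qed.

Lemma measurable_int_cons n (h : n.+1.-tuple U -> \bar R) :
  measurable_fun [set: n.+1.-tuple U] h -> (forall x, 0 <= h x)%E ->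
  measurable_fun [set: U] (fun u =>
    \int[power_prob (space_prob U) n]_y h (tuple_cons (u, y)))%E.
Proof.
move=> mh h0; apply: (@measurable_fun_fubini_tonelli_F _ _ _ _ _ _
  (h \o @tuple_cons _ U n)) => //.
  by apply: (measurableT_comp mh); exact: measurable_tuple_cons.
by move=> x; exact: h0.
Qed.

Lemma integral_tags_are i n (h : n.-tuple U -> \bar R) :
  measurable_fun [set: n.-tuple U] h -> (forall x, 0 <= h x)%E ->
  (forall x, ~ tags_are x i -> h x = 0%E) ->
  (\int[power_prob (space_prob U) n]_x h x =
   (a i ^+ n)%:E * \int[power_prob (space_prob (S i)) n]_y h (injs y))%E.
Proof.
elim: n h => [|n IH] h mh h0 hz.
  rewrite expr0 mul1e /= !integral_dirac//; last first.
    exact: (measurableT_comp mh (@measurable_injs i 0)).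
  rewrite !diracT !mul1e; congr h; exact: val_inj.
rewrite integral_power_probS// integral_union; first last.
- by move=> u; apply: integral_ge0 => y _; exact: h0.
- exact: measurable_int_cons.
rewrite (esum_single (i := i)).
- apply: integral_inj_first => // x y ny; apply: hz.
  by move=> /tags_are_cons[_].
- move=> j; rewrite mule_ge0 ?lee_fin ?weight_ge0//.
  by apply: integral_ge0 => x _; apply: integral_ge0 => y _; exact: h0.
move=> j ji; rewrite integral0_eq ?mule0// => x _.
rewrite integral0_eq// => y _; apply: hz => /tags_are_cons[/= ij _].
by rewrite ij eqxx in ji.
Qed.

Lemma integral_union_monochromatic n (h : n.-tuple U -> \bar R) : (0 < n)%N ->
  measurable_fun [set: n.-tuple U] h -> (forall x, 0 <= h x)%E ->
  (forall x, ~ (exists i, tags_are x i) -> h x = 0%E) ->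
  (\int[power_prob (space_prob U) n]_x h x =
   \esum_(i in [set: I])
     ((a i ^+ n)%:E * \int[power_prob (space_prob (S i)) n]_y h (injs y)))%E.
Proof.
case: n h => // n h _ mh h0 hz.
rewrite integral_power_probS// integral_union; first last.
- by move=> u; apply: integral_ge0 => y _; exact: h0.
- exact: measurable_int_cons.
apply: eq_esum => i _; apply: integral_inj_first => //.
  exact: integral_tags_are.
move=> x y ny; apply: hz => -[j /tags_are_cons[/= ij yj]].
by apply: ny; rewrite ij.
Qed.

Variable W : forall i, graph_kernel (S i).

(** Along an edge with nonzero factor both ends lie in the same summand, so by
    connectedness a nonzero edge product has all its points in one summand. *)
Lemma kernel_density_union F : connected_graph F ->
  (kernel_density (union_kernel a W) F =
   \esum_(i in [set: I]) ((a i ^+ nverts F)%:E * kernel_density (W i) F))%E.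
Proof.
move=> Fc; pose h := EFin \o @edge_product R U (union_kernel a W) F.
transitivity (\int[power_prob (space_prob U) (nverts F)]_x h x)%E; first by [].
rewrite integral_union_monochromatic ?nverts_gt0//.
- apply: eq_esum => i _; congr (_ * _)%E; apply: eq_integral => y _.
  congr EFin; apply: eq_bigr => p _.
  by rewrite !tnth_map /= /union_kernel_fun /= eqxx tagged_asE.
- exact: measurable_edge_product.
- by move=> x; rewrite lee_fin; exact: edge_product_ge0.
move=> x nx; congr EFin; apply/eqP; apply: contra_notT nx => px.
(* Only the pairs with i < j occur in the edge product. *)
have tag_lt (i j : 'I_(nverts F)) : (i < j)%N -> edge F i j ->
    tag (tnth x i) = tag (tnth x j).
  move=> ij eij; apply/eqP; apply: contraNT px => nij.
  apply/prodf_eq0; exists (i, j); rewrite /= ?ij ?eij//.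
  by rewrite /union_kernel_fun (negbTE nij).
have tag_edge i j : edge F i j -> tag (tnth x i) = tag (tnth x j).
  move=> eij; case: (ltngtP i j) => [ij|ji|/val_inj ->//]; first exact: tag_lt.
  by apply/esym/tag_lt => //; rewrite edge_sym.
pose x0 := Ordinal (nverts_gt0 F).
exists (tag (tnth x x0)) => k.
have /connectP[p] := Fc x0 k; move: x0; elim: p => [|z p IH] y /=.
  by move=> _ ->.
by move=> /andP[yz pz] kl; rewrite (tag_edge _ _ yz); exact: IH.
Qed.

End UnionPower.

(** * Disjoint unions of blow-ups *)

(** The graph on the ordinals obtained from a graph on any finite type by
    enumerating its vertices. *)
Section TypeGraph.
Variables (V : finType) (e : rel V).
Hypotheses (V0 : (0 < #|V|)%N) (e_sym : symmetric e) (e_irr : irreflexive e).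

Let type_edge_sym : symmetric (fun x y : 'I_#|V| => e (enum_val x) (enum_val y)).
Proof. by move=> x y; exact: e_sym. Qed.

Let type_edge_irr : irreflexive (fun x y : 'I_#|V| => e (enum_val x) (enum_val y)).
Proof. by move=> x; exact: e_irr. Qed.

Definition type_graph : graph := Graph V0 type_edge_sym type_edge_irr.

Definition is_type_hom (F : graph) (f : {ffun 'I_(nverts F) -> V}) :=
  [forall x, forall y, edge F x y ==> e (f x) (f y)].

Lemma card_type_hom F :
  #|[pred f | @is_hom F type_graph f]| = #|[pred f | @is_type_hom F f]|.
Proof.
pose M (f : {ffun 'I_(nverts F) -> V}) :
    {ffun 'I_(nverts F) -> 'I_(nverts type_graph)} :=
  [ffun x => enum_rank (f x)].
pose N (f : {ffun 'I_(nverts F) -> 'I_(nverts type_graph)}) :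
    {ffun 'I_(nverts F) -> V} := [ffun x => enum_val (f x)].
have bM : bijective M.
  by exists N => f; apply/ffunP => x; rewrite !ffunE ?enum_rankK ?enum_valK.
rewrite -!sum1_card (reindex M); last exact: onW_bij.
apply: eq_bigl => f; rewrite !inE /is_hom /is_type_hom /=.
by under eq_forallb do under eq_forallb do rewrite !ffunE !enum_rankK.
Qed.

End TypeGraph.

Section BlowupSum.
Variables (n : nat) (G : 'I_n -> graph) (b : 'I_n -> nat) (r : nat).

(** Vertices of the disjoint union of the blow-ups of the G i, each vertex of
    G i being replaced by b i copies of itself, together with r isolated
    vertices. *)
Definition blowup_vertex : finType :=
  ({i : 'I_n & ('I_(nverts (G i)) * 'I_(b i))%type} + 'I_r)%type.

Definition blowup_edge : rel blowup_vertex := fun x y =>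
  match x, y with
  | inl p, inl q =>
      (tag p == tag q) && edge (G (tag p)) (tagged p).1 (tagged_as p q).1
  | _, _ => false
  end.

Lemma blowup_edgeE i (s t : 'I_(nverts (G i)) * 'I_(b i)) :
  blowup_edge (inl (Tagged _ s)) (inl (Tagged _ t)) = edge (G i) s.1 t.1.
Proof. by rewrite /= eqxx tagged_asE. Qed.

Lemma blowup_edge_sym : symmetric blowup_edge.
Proof.
move=> [[i s]|x] [[j t]|y] //=; rewrite eq_sym; case: eqP => // ji.
by case: _ / ji s => s; rewrite !tagged_asE edge_sym.
Qed.

Lemma blowup_edge_irr : irreflexive blowup_edge.
Proof. by move=> [[i s]|x] //=; rewrite tagged_asE edge_irr andbF. Qed.

Lemma card_blowup_vertex :
  #|blowup_vertex| = (\sum_(i < n) nverts (G i) * b i + r)%N.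
Proof.
rewrite card_sum card_tagged card_ord sumnE big_map big_enum /=.
by congr (_ + _)%N; apply: eq_bigr => i _; rewrite card_prod !card_ord.
Qed.

Let blowup_map F : finType :=
  {i : 'I_n & ({ffun 'I_(nverts F) -> 'I_(nverts (G i))} *
               {ffun 'I_(nverts F) -> 'I_(b i)})%type}.

Let lift_map F (p : blowup_map F) : {ffun 'I_(nverts F) -> blowup_vertex} :=
  [ffun x => inl (Tagged _ ((tagged p).1 x, (tagged p).2 x))].

Let lift_map_inj F : injective (@lift_map F).
Proof.
move=> [i [g s]] [j [g' s']] E.
have Ex x : Tagged (fun i => ('I_(nverts (G i)) * 'I_(b i))%type) (g x, s x) =
    Tagged _ (g' x, s' x).
  have := congr1 (fun f : {ffun _ -> _} => f x) E; rewrite !ffunE.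
  by move=> /(congr1 (fun v : blowup_vertex =>
    if v is inl w then w else Tagged _ (g x, s x))).
have ij : i = j := congr1 tag (Ex (Ordinal (nverts_gt0 F))).
case: _ / ij g' s' Ex {E} => g' s' Ex.
have -> : g = g' by apply/ffunP => x; case: (eq_from_Tagged (Ex x)).
by have -> : s = s' by apply/ffunP => x; case: (eq_from_Tagged (Ex x)).
Qed.

(** Every vertex of a connected graph with an edge is the end of an edge, so
    its image is not isolated; and the image cannot leave a summand. *)
Lemma lift_map_surj F (f : {ffun 'I_(nverts F) -> blowup_vertex}) :
  connected_graph F -> has_edge F -> is_type_hom blowup_edge f ->
  exists p : blowup_map F, f = lift_map p.
Proof.
move=> Fc [u [v uv]] /forallP fhom.
have fE x y : edge F x y -> blowup_edge (f x) (f y).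
  by have /forallP/(_ y)/implyP := fhom x; exact.
pose in_summand i (t : 'I_(nverts (G i)) * 'I_(b i)) : blowup_vertex :=
  inl (existT (fun i => ('I_(nverts (G i)) * 'I_(b i))%type) i t).
have [i [t0 fu]] : exists i t, f u = in_summand i t.
  by have := fE _ _ uv; case: (f u) => // -[i t] _; exists i, t.
have fx x : exists t, f x = in_summand i t.
  have /connectP[p] := Fc u x; elim: p u t0 fu {uv} => [|z p IH] u t0 fu /=.
    by move=> _ ->; exists t0.
  move=> /andP[uz pz] xl.
  have := fE _ _ uz; rewrite fu; case Ez : (f z) => [[j t]|] //= /andP[/eqP ij _].
  by case: _ / ij t Ez => t Ez; exact: (IH z t).
have [t ft] := fin_all_exists fx.
exists (existT (fun i => ({ffun 'I_(nverts F) -> 'I_(nverts (G i))} *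
    {ffun 'I_(nverts F) -> 'I_(b i)})%type) i
  ([ffun x => (t x).1], [ffun x => (t x).2])).
by apply/ffunP => x; rewrite ft !ffunE /=; case: (t x).
Qed.

(** A homomorphism amounts to a summand i, a homomorphism to G i and the choice
    of one of the b i copies for each vertex of F. *)
Lemma card_hom_blowup F : connected_graph F -> has_edge F ->
  #|[pred f | @is_type_hom _ blowup_edge F f]| =
  (\sum_(i < n) #|[pred f | @is_hom F (G i) f]| * b i ^ nverts F)%N.
Proof.
move=> Fc Fe.
pose X : {set blowup_map F} := [set p | @is_hom F (G (tag p)) (tagged p).1]%SET.
transitivity #|X|.
  rewrite -(card_imset X (@lift_map_inj F)); apply: eq_card => f; rewrite inE.
  have homE (p : blowup_map F) : is_type_hom blowup_edge (lift_map p) = (p \in X).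
    rewrite inE /is_type_hom /is_hom.
    by under eq_forallb do under eq_forallb do rewrite !ffunE blowup_edgeE.
  apply/idP/imsetP => [fh|[p pX ->]]; last by rewrite homE.
  by have [p fp] := lift_map_surj Fc Fe fh; exists p; rewrite -?homE -?fp.
rewrite -sum1_card.
transitivity (\sum_(p : blowup_map F |
                true && @is_hom F (G (tag p)) (tagged p).1) 1)%N.
  by apply: eq_bigl => p; rewrite inE.
rewrite -(sig_big_dep predT (fun i gs => @is_hom F (G i) gs.1) (fun _ _ => 1%N)).
apply: eq_bigr => i _.
transitivity (\sum_(gs : {ffun 'I_(nverts F) -> 'I_(nverts (G i))} *
               {ffun 'I_(nverts F) -> 'I_(b i)} |
                 @is_hom F (G i) gs.1 && true) 1)%N.
  by apply: eq_bigl => gs; rewrite andbT.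
rewrite -(pair_big (fun g => @is_hom F (G i) g) predT (fun _ _ => 1%N)) /=.
rewrite -sum_nat_const; apply: eq_big => [g|g _]; rewrite ?inE//.
by rewrite sum1_card card_ffun !card_ord.
Qed.

Definition blowup_graph (V0 : (0 < #|blowup_vertex|)%N) : graph :=
  type_graph V0 blowup_edge_sym blowup_edge_irr.

Lemma hom_density_blowup (R : realType) (V0 : (0 < #|blowup_vertex|)%N) F :
  connected_graph F -> has_edge F ->
  hom_density R F (blowup_graph V0) =
  \sum_(i < n) ((nverts (G i) * b i)%:R / #|blowup_vertex|%:R) ^+ nverts F *
    hom_density R F (G i).
Proof.
move=> Fc Fe; rewrite /hom_density card_type_hom card_hom_blowup//.
rewrite natr_sum mulr_suml; apply: eq_bigr => i _.
rewrite !card_ffun !card_ord [in RHS]natrM !natrM !natrX !exprMn exprVn.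
have : (nverts (G i))%:R ^+ nverts F != 0 :> R.
  by rewrite expf_neq0// pnatr_eq0 -lt0n nverts_gt0.
move: (_ ^+ nverts F) => v v0.
by rewrite [RHS]mulrC -[v * _ / _]mulrA [RHS]mulrA divfK// mulrA.
Qed.

End BlowupSum.

(** * Finite graphs converging to a direct sum *)

Section DirectSumSequence.
Variable R : realType.

(** Tannery's theorem: dominated convergence for the counting measure, applied
    to the terms of index i < n, the others being set to 0. *)
Lemma cvg_sum_dominated (f : nat -> nat -> R) (l g : nat -> R) :
  (forall n i, 0 <= f n i <= g i) -> (forall i, f n i @[n --> \oo] --> l i) ->
  (\sum_(i <oo) (g i)%:E < +oo)%E ->
  (\sum_(i < n) f n i)%:E @[n --> \oo] --> (\sum_(i <oo) (l i)%:E)%E.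
Proof.
move=> fg fl gfin.
pose h n i : \bar R := (if (i < n)%N then f n i else 0)%:E.
have f0 n i : 0 <= f n i by case/andP: (fg n i).
have g0 i : 0 <= g i by case/andP: (fg 0%N i) => /le_trans; apply.
have l0 i : 0 <= l i.
  rewrite -(cvg_lim _ (fl i))//; apply: limr_ge; first exact: cvgP (fl i).
  exact: nearW.
have mnat (u : nat -> \bar R) : measurable_fun [set: nat] u by [].
have [|||_ _] := @dominated_convergence _ nat R (@counting nat R) setT measurableT
  h (fun i => (l i)%:E) (fun i => (g i)%:E) (fun _ => mnat _) (mnat _).
- apply: aeW => i _; apply: cvg_EFin; first by near=> n.
  apply: cvg_trans (fl i); apply: near_eq_cvg; near=> n => /=.
  by rewrite ifT//; near: n; exact: nbhs_infty_gt.
- apply/integrableP; split; first exact: mnat.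
  under eq_integral do rewrite gee0_abs ?lee_fin//.
  by rewrite ge0_integral_count// => k; rewrite lee_fin.
- apply: aeW => i n _; rewrite gee0_abs lee_fin; case: ifP => // _.
  by case/andP: (fg n i).
rewrite ge0_integral_count; last by move=> k; rewrite lee_fin.
apply: cvg_trans; apply: near_eq_cvg; near=> n => /=.
rewrite ge0_integral_count; last by move=> k; rewrite lee_fin; case: ifP.
rewrite (nneseries_split 0 n); last by move=> k _; rewrite lee_fin; case: ifP.
rewrite add0n eseries0 ?adde0; last by move=> i ni _; rewrite /h ltnNge ni.
rewrite big_mkord sumEFin; congr EFin; apply: eq_bigr => i _.
by rewrite ltn_ord.
Unshelve. all: by end_near. Qed.

Lemma hom_density_ge0 F G : 0 <= hom_density R F G.
Proof. exact: divr_ge0. Qed.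

Lemma hom_density_le1 F G : hom_density R F G <= 1.
Proof.
rewrite ler_pdivrMr ?mul1r ?ler_nat; first exact: max_card.
by rewrite ltr0n card_ffun !card_ord expn_gt0 nverts_gt0.
Qed.

Variables (A : nat -> R) (Gam : nat -> graph_limit R).
Hypothesis A0 : forall i, 0 <= A i.
Hypothesis A1 : (\sum_(i <oo) (A i)%:E <= 1)%E.

(** The number N n of vertices is so large that rounding the size of each
    blow-up down costs a proportion of vertices of at most 1 / n.+1; rounding
    down also keeps the proportion w n i of the i-th blow-up below A i, so that
    A is a dominating sequence. *)
Lemma direct_sum_sequence : exists H : nat -> graph,
  (nverts (H n) @[n --> \oo] --> \oo) /\
  (forall F, connected_graph F -> has_edge F ->
    (hom_density R F (H n))%:E @[n --> \oo] -->
      (\sum_(i <oo) (A i ^+ nverts F * Gam i F)%:E)%E).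
Proof.
have [G GP] := choice (fun i => limit_densityP (Gam i)).
pose v n i := nverts (G i n).
have v0 n i : 0 < (v n i)%:R :> R by rewrite ltr0n nverts_gt0.
pose N n := (n.+1 * (\sum_(i < n) v n i).+1)%N.
have N0 n : 0 < (N n)%:R :> R by rewrite ltr0n muln_gt0.
pose b n i := Num.truncn (A i * (N n)%:R / (v n i)%:R).
pose w n i : R := (v n i * b n i)%:R / (N n)%:R.
have x0 n i : 0 <= A i * (N n)%:R / (v n i)%:R.
  by rewrite divr_ge0 ?mulr_ge0// ltW.
have w_ge0 n i : 0 <= w n i by rewrite divr_ge0.
have w_le n i : w n i <= A i.
  rewrite ler_pdivrMr// natrM mulrC -ler_pdivlMr//.
  by have /andP[] := truncn_itv (x0 n i).
have w_ge n i : (i < n)%N -> A i - n.+1%:R^-1 <= w n i.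
  move=> ni; rewrite lerBlDr.
  have /andP[_ /ltW] := truncn_itv (x0 n i); rewrite -/(b n i) => xb.
  have {xb} : A i * (N n)%:R <= (v n i * b n i)%:R + (v n i)%:R.
    move: xb; rewrite ler_pdivrMr// -natr1 mulrDl mul1r natrM.
    by rewrite [_ * (v n i)%:R]mulrC.
  rewrite -ler_pdivlMr// mulrDl => /le_trans; apply; rewrite lerD2l.
  rewrite ler_pdivrMr// natrM mulKf ?pnatr_eq0// ler_nat.
  by rewrite ltnW// ltnS (bigD1 (Ordinal ni))//= leq_addr.
(* Needed to bound w n i ^+ nverts F by w n i. *)
have A_le1 i : A i <= 1.
  rewrite -lee_fin; apply: le_trans A1.
  apply: (@le_trans _ _ (\sum_(0 <= j < i.+1) (A j)%:E)%E).
    by rewrite big_nat_recr//= leeDr// sume_ge0// => j _; rewrite lee_fin.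
  by apply: nneseries_lim_ge => j _ _; rewrite lee_fin.
have sumN n : (\sum_(i < n) v n i * b n i <= N n)%N.
  rewrite -(ler_nat R) -[leRHS]mul1r -ler_pdivrMr// natr_sum mulr_suml.
  apply: (@le_trans _ _ (\sum_(i < n) A i)).
    by apply: ler_sum => i _; exact: w_le.
  rewrite -lee_fin; apply: le_trans A1.
  rewrite -sumEFin -(big_mkord xpredT (fun i => (A i)%:E)).
  by apply: nneseries_lim_ge => j _ _; rewrite lee_fin.
(* The number of isolated vertices that bring the total to N n. *)
pose r n := (N n - \sum_(i < n) v n i * b n i)%N.
pose V n := blowup_vertex (fun i : 'I_n => G i n) (fun i : 'I_n => b n i) (r n).
have cardV n : #|V n| = N n by rewrite card_blowup_vertex subnKC// sumN.
have V0 n : (0 < #|V n|)%N by rewrite cardV muln_gt0.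
exists (fun n => blowup_graph (V0 n)); split.
  apply/cvgnyPge => k; near=> n; rewrite /= cardV /N.
  apply: (@leq_trans n); first by near: n; exact: nbhs_infty_ge.
  by rewrite -{1}[n]muln1 leq_mul.
move=> F Fc Fe.
under eq_cvg do rewrite hom_density_blowup// cardV.
apply: (@cvg_sum_dominated
  (fun n i => w n i ^+ nverts F * hom_density R F (G i n)) _ A).
- move=> n i; rewrite mulr_ge0 ?exprn_ge0 ?hom_density_ge0//=.
  rewrite -[leRHS]mulr1 ler_pM ?exprn_ge0 ?hom_density_ge0 ?hom_density_le1//.
  apply: le_trans (w_le n i).
  rewrite -[nverts F]prednK ?nverts_gt0// exprS ler_piMr// exprn_ile1//.
  exact: le_trans (w_le n i) (A_le1 i).
- move=> i; apply: cvgM; last exact: (GP i).2.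
  have wA : w n i @[n --> \oo] --> A i.
    apply: (@squeeze_cvgr _ _ _ _ (fun n => A i - n.+1%:R^-1) (fun=> A i)).
    + near=> n; rewrite w_le andbT w_ge//; near: n; exact: nbhs_infty_gt.
    + rewrite -[X in _ --> X]subr0; apply: cvgB; first exact: cvg_cst.
      exact: cvg_harmonic.
    + exact: cvg_cst.
  exact: (cvg_comp _ _ wA (@exprn_continuous _ (nverts F) (A i))).
- exact: le_lt_trans A1 (ltry _).
Unshelve. all: by end_near. Qed.

End DirectSumSequence.

(** * Direct sums of graph limits and kernels *)

Section DirectSumKernel.
Variables (R : realType) (I : countType) (a : prob_weights R I).
Variables (S : I -> prob_space R) (W : forall i, graph_kernel (S i)).
Variable Gamma : I -> graph_limit R.
Hypothesis W_represents : forall i, represents (W i) (Gamma i).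

Let K (F : graph) : R := fine (kernel_density (union_kernel a W) F).

Let K_direct_sum F : connected_graph F ->
  ((K F)%:E = \esum_(i in [set: I]) (a i ^+ nverts F * Gamma i F)%:E)%E.
Proof.
move=> Fc; rewrite fineK ?kernel_density_fin_num// kernel_density_union//.
by apply: eq_esum => i _; rewrite EFinM W_represents.
Qed.

(** Kernel densities of the union are densities of a graph limit: this provides
    the existence of the direct sum. *)
Lemma union_kernel_limitP : exists H : nat -> graph,
  (nverts (H n) @[n --> \oo] --> \oo) /\
  (forall F, hom_density R F (H n) @[n --> \oo] --> K F).
Proof.
pose A n : R := oapp a 0 (pickle_inv n : option I).
pose Gam n : graph_limit R :=
  oapp Gamma (trivial_limit R) (pickle_inv n : option I).
have A0 n : 0 <= A n.
  by rewrite /A; case: (pickle_inv _) => //= i; exact: weight_ge0.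
have A1 : (\sum_(n <oo) (A n)%:E <= 1)%E.
  rewrite -(weight_sum1 a) esum_pickle; last first.
    by move=> i; rewrite lee_fin weight_ge0.
  by rewrite le_eqVlt; apply/orP; left; apply/eqP; apply: eq_eseriesr => n _;
    rewrite /A; case: (pickle_inv _).
have [H [Hoo HF]] := direct_sum_sequence Gam A0 A1.
exists H; split=> //; apply: split_multiplicative_cvg.
- by move=> n; exact: hom_density_multiplicative.
- exact: kernel_density_multiplicative.
move=> F Fc Fe; apply: (fine_cvg (f := fun n => (hom_density R F (H n))%:E)).
rewrite [X in _ --> X](_ : _ = \sum_(n <oo) (A n ^+ nverts F * Gam n F)%:E)%E.
  exact: HF.
rewrite K_direct_sum// esum_pickle; last first.
  move=> i; rewrite EFinM W_represents mule_ge0 ?lee_fin ?exprn_ge0 ?weight_ge0//.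
  by apply: integral_ge0 => x _; rewrite lee_fin; exact: edge_product_ge0.
apply: eq_eseriesr => n _.
rewrite /A /Gam; case: (pickle_inv _) => //=.
by rewrite expr0n gtn_eqF ?nverts_gt0// mul0r.
Qed.

Lemma direct_sum_represented : represents (union_kernel a W) (direct_sum a Gamma).
Proof.
pose L := GraphLimit union_kernel_limitP.
have dsL : is_direct_sum a Gamma L by move=> F Fc _; exact: K_direct_sum.
have dsD : is_direct_sum a Gamma (direct_sum a Gamma).
  by have /= := @xgetI _ (trivial_limit R) [set L | is_direct_sum a Gamma L] L dsL.
move=> F; rewrite -[RHS]fineK ?kernel_density_fin_num//; congr EFin.
move: F; apply: (split_multiplicative_eq (f := direct_sum a Gamma) (g := K)).
- exact: graph_limit_multiplicative.
- exact: kernel_density_multiplicative.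
by move=> F Fc Fe; apply: EFin_inj; rewrite dsD// K_direct_sum.
Qed.

End DirectSumKernel.

Lemma zero_kernel_represents (R : realType) (S0 : prob_space R) :
  represents (zero_kernel S0) (trivial_limit R).
Proof.
move=> F; rewrite /kernel_density /= /trivial_density.
rewrite (eq_integral (cst (if [exists x, exists y, edge F x y] then 0 else 1)%:E)).
  by rewrite integral_cst// [X in (_ * X)%E]probability_setT mule1.
move=> x _; congr EFin; case: ifPn => [/existsP[u /existsP[v uv]]|nF].
  have /orP[ltuv|ltvu] : (u < v)%N || (v < u)%N.
    by rewrite -neq_ltn; apply: contraTneq uv => /val_inj ->; rewrite edge_irr.
  - by rewrite (bigD1 (u, v)) /= ?ltuv// mul0r.
  - have vu : edge F v u by rewrite edge_sym.
    by rewrite (bigD1 (v, u)) /= ?ltvu// mul0r.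
rewrite big1// => -[u v] /= /andP[_ uv]; case/negP: nF.
by apply/existsP; exists u; apply/existsP; exists v.
Qed.

Lemma graph_limit_ge0 (R : realType) (L : graph_limit R) F : 0 <= L F.
Proof.
have [H [_ HL]] := limit_densityP L; rewrite -(cvg_lim _ (HL F))//.
apply: limr_ge; first exact: cvgP (HL F).
by apply: nearW => n; exact: hom_density_ge0.
Qed.

(** The additional summand is the trivial limit, which has density 0 for every
    graph with an edge. *)
Lemma direct_sum_fill (R : realType) (I : countType) (alpha : I -> R)
    (alpha' : option I -> R)
    (Gamma : I -> graph_limit R) :
  (forall o, 0 <= alpha' o) -> (forall i, alpha' (Some i) = alpha i) ->
  direct_sum alpha' (oapp Gamma (trivial_limit R)) = direct_sum alpha Gamma.
Proof.
move=> alpha'0 alpha'E; rewrite /direct_sum; congr xget; apply/funext => L.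
have E F : has_edge F ->
    (\esum_(o in [set: option I])
      (alpha' o ^+ nverts F * (oapp Gamma (trivial_limit R) o) F)%:E =
     \esum_(i in [set: I]) (alpha i ^+ nverts F * Gamma i F)%:E)%E.
  move=> [x [y xy]]; rewrite (esumID [set None]); last first.
    by move=> o _; rewrite lee_fin mulr_ge0 ?graph_limit_ge0// exprn_ge0.
  have trivial0 : trivial_density R F = 0.
    rewrite /trivial_density ifT//.
    by apply/existsP; exists x; apply/existsP; exists y.
  rewrite setTI esum_set1/= trivial0 mulr0 ?lexx// add0e.
  rewrite (reindex_esum [set: I] _ Some); last first.
    split; first by [].
    - by move=> i j _ _ [].
    - by move=> [i|] [_ /= H] //; exists i.
  by apply: eq_esum => i _; rewrite alpha'E.
by apply/propext; split=> Lds F Fc Fe; rewrite Lds// E.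
Qed.

Theorem theorem1p18 (R : realType) (m : option nat)
    (Gamma : idx m -> graph_limit R) (alpha : idx m -> R)
    (alpha_ge0 : forall i, 0 <= alpha i)
    (alpha_le1 : (\esum_(i in [set: idx m]) (alpha i)%:E <= 1)%E)
    (S : idx m -> prob_space R) (W : forall i, graph_kernel (S i))
    (W_represents : forall i, represents (W i) (Gamma i)) :
  (forall alpha_sum1 : (\esum_(i in [set: idx m]) (alpha i)%:E = 1)%E,
    represents (union_kernel (ProbWeights alpha_ge0 alpha_sum1) W)
      (direct_sum alpha Gamma)) /\
  ((\esum_(i in [set: idx m]) (alpha i)%:E < 1)%E ->
    forall S0 : prob_space R,
    represents
      (union_kernel (fill_weights alpha_ge0 alpha_le1) (fill_kernel S0 W))
      (direct_sum alpha Gamma)).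
Proof.
split=> [alpha_sum1|_ S0].
  exact: (direct_sum_represented (ProbWeights alpha_ge0 alpha_sum1)).
rewrite -(direct_sum_fill Gamma
  (weight_ge0 (fill_weights alpha_ge0 alpha_le1)))//.
apply: direct_sum_represented => -[i|] /=; first exact: W_represents.
exact: zero_kernel_represents.
Qed.
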